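(* Let $\mathcal D_1$ be the complex Lie algebra with basis $e_1,e_2,e_3$ and only non-zero brackets $[e_3,e_1]=e_1$, $[e_3,e_2]=e_2$. For a representation of $\mathcal D_1$ in one of the cases (AI)–(AVII), (BI), (BII) listed in the context, there exist bijective 1-cocycles if and only if it is equivalent to one of the representations listed below under the corresponding case. For each, the bijective 1-cocycles, classified up to equivalence, and the corresponding left-symmetric algebras (non-zero products) are as follows. Case (AI): $a=b=1$, $c=\lambda\in\mathbb C$: $q=(v_1,v_2,v_3)$; $(\bar{\rm D}_1\text{-}1)_\lambda$: $e_3e_1=e_1$, $e_3e_2=e_2$, $e_3e_3=\lambda e_3$. Case (AII): $a=c=1$: $q=(v_3,v_1,v_2)$; $(\bar{\rm D}_1\text{-}2)$: $e_3e_1=e_1$, $e_3e_2=e_2$, $e_3e_3=e_3+e_2$. Case (AIII): there does not exist any bijective 1-cocycle. Case (AIV): $b=\lambda\neq0$, $c=1$: $q=(v_3,v_1,\lambda v_2)$; $(\bar{\rm D}_1\text{-}3)_\lambda$: $e_2e_3=\lambda e_2$, $e_3e_1=e_1$, $e_3e_2=(\lambda+1)e_2$, $e_3e_3=\lambda e_3$. When $\lambda=-1$ there is an additional equivalence class $q=(v_3,v_1,v_1-v_2)$; $(\bar{\rm D}_1\text{-}4)$: $e_2e_3=-e_2$, $e_3e_1=e_1$, $e_3e_3=-e_3+e_2$. When $\lambda=1$ there is an additional equivalence class $q=(v_3,v_2,v_1)$; $(\bar{\rm D}_1\text{-}5)$: $e_2e_2=e_3$, $e_3e_1=e_1$, $e_3e_2=e_2$,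 $e_3e_3=2e_3$. Case (AV): $c=1$: $q=(v_1,v_3,v_2)$; $(\bar{\rm D}_1\text{-}6)$: $e_2e_3=e_1$, $e_3e_1=e_1$, $e_3e_2=e_1+e_2$. Case (AVI): $c=1$: $q=(v_1,v_2,v_3)$; $(\bar{\rm D}_1\text{-}7)$: $e_2e_3=e_2$, $e_3e_1=e_1$, $e_3e_2=2e_2$, $e_3e_3=e_3+e_1$. Case (AVII): $c=-1$: $q=(v_1,v_2,-v_3)$; $(\bar{\rm D}_1\text{-}8)$: $e_2e_2=e_1$, $e_2e_3=-e_2$, $e_3e_1=e_1$, $e_3e_3=-e_3$. Case (BI): $c=1$: $q=(v_1,v_3,v_2)$; $(\bar{\rm D}_1\text{-}9)$: $e_1e_3=e_1$, $e_2e_2=e_1$, $e_3e_1=2e_1$, $e_3e_2=e_2$, $e_3e_3=e_3$; and $q=(v_2,v_3,v_1)$; $(\bar{\rm D}_1\text{-}10)$: $e_1e_1=e_3$, $e_2e_2=e_3$, $e_3e_1=e_1$, $e_3e_2=e_2$, $e_3e_3=2e_3$. Case (BII): $c=\lambda\neq0$: $q=(v_2,v_1,\lambda v_3)$; $(\bar{\rm D}_1\text{-}11)_\lambda$: $e_1e_3=\lambda e_1$, $e_2e_3=\lambda e_2$, $e_3e_1=(\lambda+1)e_1$, $e_3e_2=(\lambda+1)e_2$, $e_3e_3=\lambda e_3$. When $\lambda=-1$ there is an additional equivalence class $q=(v_2,v_1,v_1-v_3)$; $(\bar{\rm D}_1\text{-}12)$: $e_1e_3=-e_1$, $e_2e_3=-e_2$,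 $e_3e_3=-e_3+e_2$.
   Context: $V$ has basis $v_1,v_2,v_3$; $E_{ij}\in gl(V)$ is the operator $v_i\mapsto v_j$, $v_k\mapsto0$ for $k\ne i$; $\mathrm{diag}(a,b,c)$ is $v_1\mapsto av_1,v_2\mapsto bv_2,v_3\mapsto cv_3$; $I$ is the identity. A linear map $q:\mathcal D_1\to V$ is written $q=(q(e_1),q(e_2),q(e_3))$. Cases of representations of $\mathcal D_1$ (complex parameters): in cases (A·), $f(e_1)=0$ and: (AI) $f(e_2)=0$, $f(e_3)=\mathrm{diag}(a,b,c)$; (AII) $f(e_2)=0$, $f(e_3)=\mathrm{diag}(a,a,c)+E_{21}$; (AIII) $f(e_2)=0$, $f(e_3)=aI+E_{21}+E_{32}$; (AIV) $f(e_2)=E_{21}$, $f(e_3)=\mathrm{diag}(b+1,b,c)$; (AV) $f(e_2)=E_{21}$, $f(e_3)=\mathrm{diag}(c,c-1,c)+E_{31}$; (AVI) $f(e_2)=E_{32}$, $f(e_3)=\mathrm{diag}(c,c+1,c)+E_{31}$; (AVII) $f(e_2)=E_{21}+E_{32}$, $f(e_3)=\mathrm{diag}(c+2,c+1,c)$. Further: (BI) $f(e_1)=E_{21}$, $f(e_2)=E_{31}$, $f(e_3)=\mathrm{diag}(c+1,c,c)$; (BII) $f(e_1)=E_{32}$, $f(e_2)=E_{31}$, $f(e_3)=\mathrm{diag}(c+1,c+1,c)$. A left-symmetric algebra is a vector space with a bilinear product satisfying $(xy)z-x(yz)=(yx)z-y(xz)$. For a representation $f:\mathcal G\to gl(V)$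 of a Lie algebra, a 1-cocycle associated to $f$ is a linear map $q:\mathcal G\to V$ with $q([x,y])=f(x)q(y)-f(y)q(x)$; it is bijective if $q$ is a linear isomorphism. A bijective 1-cocycle $(f,q)$ has the corresponding left-symmetric algebra $x*y=q^{-1}(f(x)q(y))$ on $\mathcal G$, whose commutator is the bracket of $\mathcal G$. Representations $(f_1,V_1),(f_2,V_2)$ are equivalent if $f_2(x)=g f_1(T(x))g^{-1}$ for some automorphism $T$ of $\mathcal G$ and linear isomorphism $g:V_1\to V_2$. Bijective 1-cocycles $(f_1,q_1),(f_2,q_2)$ are equivalent if there are such $T,g$ with $f_2(x)=g f_1(T(x))g^{-1}$ and $q_2=g q_1T$. *)

(* Defs.v *)
From HB Require Import structures.
From mathcomp Require Import all_boot all_order all_algebra.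
From mathcomp Require Import ring.
From mathcomp Require Export reals complex.

Set Implicit Arguments.
Unset Strict Implicit.
Unset Printing Implicit Defensive.

Import GRing.Theory.
Local Open Scope ring_scope.

Definition o1 : 'I_3 := @Ordinal 3 0 isT.
Definition o2 : 'I_3 := @Ordinal 3 1 isT.
Definition o3 : 'I_3 := @Ordinal 3 2 isT.

(* The underlying space of D_1 and the space V are both 'cV[K]_3, with the
   canonical basis called e1, e2, e3 in the former and v1, v2, v3 in the
   latter.  A linear map q or T between such spaces is a matrix acting on
   the left, x |-> q *m x; likewise gl(V) is 'M[K]_3. *)
Definition e1 {K : fieldType} : 'cV[K]_3 := delta_mx o1 0.
Definition e2 {K : fieldType} : 'cV[K]_3 := delta_mx o2 0.
Definition e3 {K : fieldType} : 'cV[K]_3 := delta_mx o3 0.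
Definition v1 {K : fieldType} : 'cV[K]_3 := delta_mx o1 0.
Definition v2 {K : fieldType} : 'cV[K]_3 := delta_mx o2 0.
Definition v3 {K : fieldType} : 'cV[K]_3 := delta_mx o3 0.

(* E_{ij} sends v_i to v_j, so its nonzero entry is in row j and column i. *)
Definition E21 {K : fieldType} : 'M[K]_3 := delta_mx o1 o2.
Definition E31 {K : fieldType} : 'M[K]_3 := delta_mx o1 o3.
Definition E32 {K : fieldType} : 'M[K]_3 := delta_mx o2 o3.

Definition diag3 {K : fieldType} (a b c : K) : 'M[K]_3 :=
  diag_mx (\row_j nth 0 [:: a; b; c] j).

(* The linear map written (w1, w2, w3), i.e. e_i |-> w_i. *)
Definition lmap3 {K : fieldType} (w1 w2 w3 : 'cV[K]_3) : 'M[K]_3 :=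
  \matrix_(i, j) nth 0 [:: w1; w2; w3] j i 0.

(* A bilinear product on the span of e1, e2, e3 is given by the list of its
   nonzero values on the basis: an entry ((i, j), w) means e_i e_j = w. *)
Definition table (K : fieldType) := seq ('I_3 * 'I_3 * 'cV[K]_3).

Definition prod_of {K : fieldType} (t : table K) (x y : 'cV[K]_3) : 'cV[K]_3 :=
  \sum_(p <- t) (x p.1.1 0 * y p.1.2 0) *: p.2.

Definition D1_bracket {K : fieldType} : 'cV[K]_3 -> 'cV[K]_3 -> 'cV[K]_3 :=
  prod_of [:: ((o3, o1), e1); ((o1, o3), - e1);
              ((o3, o2), e2); ((o2, o3), - e2)].

Structure D1_repr (K : fieldType) := D1Repr {
  D1_fun :> {linear 'cV[K]_3 -> 'M[K]_3};
  D1_funB : forall x y : 'cV[K]_3,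
    D1_fun (D1_bracket x y) =
    D1_fun x *m D1_fun y - D1_fun y *m D1_fun x
}.

Definition D1_aut {K : fieldType} (T : 'M[K]_3) : Prop :=
  T \in unitmx /\
  forall x y : 'cV[K]_3, T *m D1_bracket x y = D1_bracket (T *m x) (T *m y).

Definition equiv_repr {K : fieldType} (f f' : D1_repr K) : Prop :=
  exists T g : 'M[K]_3,
    [/\ D1_aut T, g \in unitmx &
        forall x, f' x = g *m f (T *m x) *m invmx g].

Definition bij_cocycle {K : fieldType} (f : D1_repr K) (q : 'M[K]_3) : Prop :=
  (forall x y : 'cV[K]_3,
     q *m D1_bracket x y = f x *m (q *m y) - f y *m (q *m x)) /\
  q \in unitmx.

Definition equiv_cocycle {K : fieldType}
    (f : D1_repr K) (q : 'M[K]_3) (f' : D1_repr K) (q' : 'M[K]_3) : Prop :=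
  exists T g : 'M[K]_3,
    [/\ D1_aut T, g \in unitmx,
        forall x, f' x = g *m f (T *m x) *m invmx g &
        q' = g *m q *m T].

Definition left_symmetric {K : fieldType}
    (m : 'cV[K]_3 -> 'cV[K]_3 -> 'cV[K]_3) : Prop :=
  [/\ forall x, linear (m x), forall y, linear (m^~ y) &
      forall x y z, m (m x y) z - m x (m y z) = m (m y x) z - m y (m x z)].

Definition corresponding_lsa {K : fieldType} (f : D1_repr K) (q : 'M[K]_3)
    (m : 'cV[K]_3 -> 'cV[K]_3 -> 'cV[K]_3) : Prop :=
  left_symmetric m /\ forall x y, m x y = invmx q *m (f x *m (q *m y)).

(* L is a complete and irredundant list of the bijective 1-cocycles associated
   to f up to equivalence, each one with the table of its left-symmetric
   algebra. *)
Definition classification {K : fieldType} (f : D1_repr K)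
    (L : seq ('M[K]_3 * table K)) : Prop :=
  [/\ forall p, p \in L ->
        bij_cocycle f p.1 /\ corresponding_lsa f p.1 (prod_of p.2),
      forall q, bij_cocycle f q ->
        exists2 p, p \in L & equiv_cocycle f q f p.1 &
      forall p p', p \in L -> p' \in L ->
        equiv_cocycle f p.1 f p'.1 -> p = p'].

Section ReprOfBasis.
Variable K : fieldType.

Definition D1_relations (F1 F2 F3 : 'M[K]_3) : Prop :=
  [/\ F1 *m F2 - F2 *m F1 = 0, F3 *m F1 - F1 *m F3 = F1 &
      F3 *m F2 - F2 *m F3 = F2].

Variables F1 F2 F3 : 'M[K]_3.

Definition basis_fun (x : 'cV[K]_3) : 'M[K]_3 :=
  x o1 0 *: F1 + x o2 0 *: F2 + x o3 0 *: F3.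

Lemma basis_fun_is_linear : linear basis_fun.
Proof.
move=> k x y; rewrite /basis_fun !mxE; apply/matrixP => i j; rewrite !mxE.
by ring.
Qed.

HB.instance Definition _ :=
  GRing.isLinear.Build K 'cV[K]_3 'M[K]_3 _ basis_fun basis_fun_is_linear.

Lemma basis_funB : D1_relations F1 F2 F3 -> forall x y : 'cV[K]_3,
  basis_fun (D1_bracket x y) =
  basis_fun x *m basis_fun y - basis_fun y *m basis_fun x.
Proof.
case=> h12 h31 h32 x y.
have entry (A B C : 'M[K]_3) : A *m B - B *m A = C ->
    forall i j, (A *m B) i j = (B *m A) i j + C i j.
  by move=> /(canRL (subrK _)) -> i j; rewrite mxE addrC.
move/entry in h12; move/entry in h31; move/entry in h32.
rewrite /basis_fun /D1_bracket /prod_of !big_cons !big_nil /=.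
rewrite !(mulmxDl, mulmxDr) -!scalemxAl -!scalemxAr.
apply/matrixP => i j.
have := h12 i j; have := h31 i j; have := h32 i j.
rewrite [(0 : 'M_3) i j]mxE.
move: (F1 *m F2) (F2 *m F1) (F3 *m F1) (F1 *m F3) (F3 *m F2) (F2 *m F3).
move: (F1 *m F1) (F2 *m F2) (F3 *m F3).
move=> F11 F22 F33 F12 F21 F31 F13 F32 F23 q32 q31 q12.
by rewrite !mxE /= q12 q31 q32; ring.
Qed.

(* The representation with f(e_i) = F_i. *)
Definition repr_of (h : D1_relations F1 F2 F3) : D1_repr K :=
  @D1Repr K basis_fun (basis_funB h).

End ReprOfBasis.

Section Cases.
Variable K : fieldType.
Implicit Types a b c : K.

Ltac solve_rel :=
  split; apply/matrixP => -[[|[|[|i]]] hi] // [[|[|[|j]]] hj] //;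
  rewrite !mxE !big_ord_recl !big_ord0 !mxE /=;
  rewrite ?mulr1n ?mulr0n; ring.

Lemma AI_rel a b c : D1_relations 0 0 (diag3 a b c).
Proof. by solve_rel. Qed.
Lemma AII_rel a c : D1_relations 0 0 (diag3 a a c + E21).
Proof. by solve_rel. Qed.
Lemma AIII_rel a : D1_relations 0 0 (a%:M + E21 + E32).
Proof. by solve_rel. Qed.
Lemma AIV_rel b c : D1_relations 0 E21 (diag3 (b + 1) b c).
Proof. by solve_rel. Qed.
Lemma AV_rel c : D1_relations 0 E21 (diag3 c (c - 1) c + E31).
Proof. by solve_rel. Qed.
Lemma AVI_rel c : D1_relations 0 E32 (diag3 c (c + 1) c + E31).
Proof. by solve_rel. Qed.
Lemma AVII_rel c : D1_relations 0 (E21 + E32) (diag3 (c + 2%:R) (c + 1) c).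
Proof. by solve_rel. Qed.
Lemma BI_rel c : D1_relations E21 E31 (diag3 (c + 1) c c).
Proof. by solve_rel. Qed.
Lemma BII_rel c : D1_relations E32 E31 (diag3 (c + 1) (c + 1) c).
Proof. by solve_rel. Qed.

Definition AI a b c := repr_of (AI_rel a b c).
Definition AII a c := repr_of (AII_rel a c).
Definition AIII a := repr_of (AIII_rel a).
Definition AIV b c := repr_of (AIV_rel b c).
Definition AV c := repr_of (AV_rel c).
Definition AVI c := repr_of (AVI_rel c).
Definition AVII c := repr_of (AVII_rel c).
Definition BI c := repr_of (BI_rel c).
Definition BII c := repr_of (BII_rel c).

End Cases.

(* Main.v *)
Require Import Defs.
From mathcomp Require Import all_boot all_order all_algebra.
From mathcomp Require Import ring.

Set Implicit Arguments.
Unset Strict Implicit.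
Unset Printing Implicit Defensive.

Import GRing.Theory Num.Theory.
Local Open Scope ring_scope.

(** Since [x, y] = x_3 y - y_3 x in D_1, a linear map T is an automorphism
exactly when it is invertible with third row (0, 0, 1) (D1_autE), and with
F_i = f(e_i) a matrix q with columns q_1, q_2, q_3 is a 1-cocycle exactly when
  F_1 q_2 = F_2 q_1,  F_3 q_1 - F_1 q_3 = q_1,  F_3 q_2 - F_2 q_3 = q_2
(bij_cocycleE).  Likewise, an equivalence between two cocycles amounts to three
matrix equations on the images of the basis and one equation q' = g q T
(equiv_cocycleI, equiv_cocycleE).

In each family these linear equations, together with det q != 0, force the
parameters announced in the theorem and leave a short explicit form for q
(the lemmas named _cocycle_form).  A residual q is then carried to a listed one
by explicit T and g.  Typically T rescales e_1 and e_2, subtracts a multiple of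
e_1 from e_2, and replaces e_3 by e_3 + c e_1 + f e_2; the last operation changes
F_3 into F_3 + c F_1 + f F_2, which a unipotent g conjugates back to F_3.  In
(AIV) and (BII), the change of q_3 along v_1 that this produces is a multiple of
lam + 1, so for lam = -1 that coordinate cannot be removed, and one more class
appears.  For lam = 1 in (AIV), the eigenvalue 1 of F_3 has multiplicity two and
q_2 acquires a new coefficient r, whose vanishing is invariant under equivalence.

The case (BI) is a classification of quadratic forms: after a cyclic
permutation of its rows, q is a symmetric matrix Q, and the equivalences
replace Q by k T^t Q T with T an automorphism of D_1 and k != 0
(BI_congruence).  The rank of the upper left 2 x 2 block of Q is 1 or 2, and
over an algebraically closed field it determines the class.

The left-symmetric identity needs no separate verification on the tables: the
product q^-1 (f(x) q(y)) always satisfies it, because its commutator is the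
bracket and f is a representation (corresponding_lsa_of). *)

(** * Explicit 3 x 3 matrices and column vectors *)

Section Explicit.
Variable K : fieldType.

(** The column vector with coordinates x, y, z. *)
Definition cv3 (x y z : K) : 'cV[K]_3 := \col_i nth 0 [:: x; y; z] i.

(** The 3 x 3 matrix with the given entries, read row by row. *)
Definition mx3 (a b c d e f g h i : K) : 'M[K]_3 :=
  lmap3 (cv3 a d g) (cv3 b e h) (cv3 c f i).

Lemma cv3_eta (u : 'cV[K]_3) : u = cv3 (u o1 0) (u o2 0) (u o3 0).
Proof.
by apply/matrixP => -[[|[|[|i]]] hi] // j; rewrite !mxE ord1 //=;
  congr (u _ _); apply: val_inj.
Qed.

Lemma cv3_inj x y z x' y' z' :
  cv3 x y z = cv3 x' y' z' -> [/\ x = x', y = y' & z = z'].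
Proof.
move=> /colP h; split.
- by have := h o1; rewrite !mxE.
- by have := h o2; rewrite !mxE.
- by have := h o3; rewrite !mxE.
Qed.

Lemma lmap3_eta (q : 'M[K]_3) : q = lmap3 (col o1 q) (col o2 q) (col o3 q).
Proof.
apply/matrixP => i -[[|[|[|j]]] hj] //; rewrite !mxE /= ?mxE;
  by congr (q _ _); apply: val_inj.
Qed.

Lemma mx3_eta (q : 'M[K]_3) :
  q = mx3 (q o1 o1) (q o1 o2) (q o1 o3) (q o2 o1) (q o2 o2) (q o2 o3)
          (q o3 o1) (q o3 o2) (q o3 o3).
Proof.
rewrite {1}[q]lmap3_eta /mx3 [col o1 q]cv3_eta [col o2 q]cv3_eta.
by rewrite [col o3 q]cv3_eta !mxE.
Qed.

Lemma lmap3_inj (u v w u' v' w' : 'cV[K]_3) :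
  lmap3 u v w = lmap3 u' v' w' -> [/\ u = u', v = v' & w = w'].
Proof.
move=> /matrixP h; split; apply/matrixP => i j; rewrite ord1.
- by have := h i o1; rewrite !mxE.
- by have := h i o2; rewrite !mxE.
- by have := h i o3; rewrite !mxE.
Qed.

Lemma lmap3_cv3 a b c d e f g h i :
  lmap3 (cv3 a d g) (cv3 b e h) (cv3 c f i) = mx3 a b c d e f g h i.
Proof. by []. Qed.

Lemma mx3_inj a b c d e f g h i a' b' c' d' e' f' g' h' i' :
  mx3 a b c d e f g h i = mx3 a' b' c' d' e' f' g' h' i' ->
  [/\ [/\ a = a', b = b' & c = c'], [/\ d = d', e = e' & f = f'] &
      [/\ g = g', h = h' & i = i']].
Proof.
by case/lmap3_inj=> /cv3_inj[-> -> ->] /cv3_inj[-> -> ->] /cv3_inj[-> -> ->].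
Qed.

Lemma mulmx_lmap3 (A : 'M[K]_3) u v w :
  A *m lmap3 u v w = lmap3 (A *m u) (A *m v) (A *m w).
Proof.
by apply/matrixP => i -[[|[|[|j]]] hj] //; rewrite !mxE; apply: eq_bigr => k _;
  rewrite !mxE.
Qed.

Lemma cv3D x y z x' y' z' :
  cv3 x y z + cv3 x' y' z' = cv3 (x + x') (y + y') (z + z').
Proof. by apply/matrixP => -[[|[|[|i]]] hi] // j; rewrite !mxE. Qed.

Lemma cv3N x y z : - cv3 x y z = cv3 (- x) (- y) (- z).
Proof. by apply/matrixP => -[[|[|[|i]]] hi] // j; rewrite !mxE. Qed.

Lemma cv3Z k x y z : k *: cv3 x y z = cv3 (k * x) (k * y) (k * z).
Proof. by apply/matrixP => -[[|[|[|i]]] hi] // j; rewrite !mxE. Qed.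

Lemma mulmx_cv3 a b c d e f g h i x y z :
  mx3 a b c d e f g h i *m cv3 x y z =
  cv3 (a * x + b * y + c * z) (d * x + e * y + f * z) (g * x + h * y + i * z).
Proof.
by apply/matrixP => -[[|[|[|k]]] hk] // j;
  rewrite !mxE !big_ord_recl !big_ord0 !mxE /= addr0 addrA.
Qed.

Lemma mx3M a b c d e f g h i a' b' c' d' e' f' g' h' i' :
  mx3 a b c d e f g h i *m mx3 a' b' c' d' e' f' g' h' i' =
  mx3 (a * a' + b * d' + c * g') (a * b' + b * e' + c * h')
      (a * c' + b * f' + c * i')
      (d * a' + e * d' + f * g') (d * b' + e * e' + f * h')
      (d * c' + e * f' + f * i')
      (g * a' + h * d' + i * g') (g * b' + h * e' + i * h')
      (g * c' + h * f' + i * i').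
Proof. by rewrite [X in _ *m X]/mx3 mulmx_lmap3 !mulmx_cv3. Qed.

Lemma mx3D a b c d e f g h i a' b' c' d' e' f' g' h' i' :
  mx3 a b c d e f g h i + mx3 a' b' c' d' e' f' g' h' i' =
  mx3 (a + a') (b + b') (c + c') (d + d') (e + e') (f + f')
      (g + g') (h + h') (i + i').
Proof.
by apply/matrixP => -[[|[|[|k]]] hk] // [[|[|[|j]]] hj] //; rewrite !mxE.
Qed.

Lemma mx3Z k a b c d e f g h i :
  k *: mx3 a b c d e f g h i =
  mx3 (k * a) (k * b) (k * c) (k * d) (k * e) (k * f) (k * g) (k * h) (k * i).
Proof.
by apply/matrixP => -[[|[|[|l]]] hl] // [[|[|[|j]]] hj] //; rewrite !mxE.
Qed.

Lemma unit_mx3 a b c d e f g h i :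
  (mx3 a b c d e f g h i \in unitmx) =
  (a * (e * i - f * h) - b * (d * i - f * g) + c * (d * h - e * g) != 0).
Proof.
rewrite unitmxE unitfE; congr (_ != 0).
do 2!rewrite !(expand_det_row _ ord0) !big_ord_recl !big_ord0 /cofactor.
by rewrite !det_mx11 !mxE /=; ring.
Qed.

Lemma mx3_0 : 0 = mx3 0 0 0 0 0 0 0 0 0.
Proof.
by apply/matrixP => -[[|[|[|k]]] hk] // [[|[|[|j]]] hj] //; rewrite !mxE.
Qed.

Lemma mx3_scalar a : a%:M = mx3 a 0 0 0 a 0 0 0 a.
Proof.
by apply/matrixP => -[[|[|[|k]]] hk] // [[|[|[|j]]] hj] //; rewrite !mxE.
Qed.

Lemma mx3_diag a b c : diag3 a b c = mx3 a 0 0 0 b 0 0 0 c.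
Proof.
by apply/matrixP => -[[|[|[|k]]] hk] // [[|[|[|j]]] hj] //; rewrite !mxE.
Qed.

Lemma mx3_E21 : E21 = mx3 0 1 0 0 0 0 0 0 0.
Proof.
by apply/matrixP => -[[|[|[|k]]] hk] // [[|[|[|j]]] hj] //; rewrite !mxE.
Qed.

Lemma mx3_E31 : E31 = mx3 0 0 1 0 0 0 0 0 0.
Proof.
by apply/matrixP => -[[|[|[|k]]] hk] // [[|[|[|j]]] hj] //; rewrite !mxE.
Qed.

Lemma mx3_E32 : E32 = mx3 0 0 0 0 0 1 0 0 0.
Proof.
by apply/matrixP => -[[|[|[|k]]] hk] // [[|[|[|j]]] hj] //; rewrite !mxE.
Qed.

(** The matrices entering the images F_i of the basis, in explicit form. *)
Definition mx3_F := (mx3_0, mx3_diag, mx3_E21, mx3_E31, mx3_E32, mx3_scalar).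

Lemma cv3_v1 : v1 = cv3 1 0 0.
Proof. by apply/matrixP => -[[|[|[|k]]] hk] // j; rewrite !mxE ord1. Qed.

Lemma cv3_v2 : v2 = cv3 0 1 0.
Proof. by apply/matrixP => -[[|[|[|k]]] hk] // j; rewrite !mxE ord1. Qed.

Lemma cv3_v3 : v3 = cv3 0 0 1.
Proof. by apply/matrixP => -[[|[|[|k]]] hk] // j; rewrite !mxE ord1. Qed.
Definition cv3_v :=
  (cv3_v1, cv3_v2, cv3_v3,
   cv3_v1 : e1 = _, cv3_v2 : e2 = _, cv3_v3 : e3 = _).
Definition cv3E := (cv3_v, cv3Z, cv3N, cv3D).

End Explicit.

(** * Automorphisms, cocycles and equivalences in coordinates *)

Section Cocycles.
Variable K : fieldType.

Lemma D1_bracketE (x y : 'cV[K]_3) :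
  D1_bracket x y = x o3 0 *: y - y o3 0 *: x.
Proof.
rewrite /D1_bracket /prod_of !big_cons big_nil /= addr0.
rewrite [y in RHS]cv3_eta [x in RHS]cv3_eta !cv3E; congr cv3; rewrite !mxE /=; ring.
Qed.

Lemma D1_autE (T : 'M[K]_3) :
  D1_aut T <->
  T \in unitmx /\ [/\ T o3 o1 = 0, T o3 o2 = 0 & T o3 o3 = 1].
Proof.
split=> -[hu].
  move=> hT; split=> //.
  have entE i : (T *m (delta_mx i 0 : 'cV_3)) o3 0 = T o3 i.
    by rewrite -colE mxE.
  have key i : i != o3 -> T o3 i = 0 /\ T o3 o3 = 1.
    move=> hi; have hi1 := negbTE hi; have hi2 : (o3 == i) = false by rewrite eq_sym.
    have := hT e3 (delta_mx i 0).
    rewrite !D1_bracketE !entE !scalemxAr -mulmxBr.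
    move/(can_inj (mulKmx hu))/matrixP => h; split.
      have := h o3 0; rewrite !mxE !eqxx ?hi1 ?hi2 /=.
      by rewrite !(mulr0, mulr1, subr0, sub0r) => /oppr_inj.
    have := h i 0; rewrite !mxE !eqxx ?hi1 ?hi2 /=.
    by rewrite !(mulr0, mulr1, mul0r, subr0, sub0r).
  by have [-> ->] := key o1 isT; have [-> _] := key o2 isT.
case=> h1 h2 h3; split=> // x y.
have rowE (u : 'cV[K]_3) : (T *m u) o3 0 = u o3 0.
  rewrite [T]mx3_eta [u]cv3_eta mulmx_cv3 h1 h2 h3 !mxE /=; ring.
by rewrite !D1_bracketE !rowE mulmxBr !scalemxAr.
Qed.

Lemma D1_aut_inv (T : 'M[K]_3) : D1_aut T -> D1_aut (invmx T).
Proof.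
case=> hu hT; split; first by rewrite unitmx_inv.
move=> x y; rewrite -[x in LHS](mulKVmx hu) -[y in LHS](mulKVmx hu).
by rewrite -hT mulKmx.
Qed.

Lemma D1_aut_mul (T T' : 'M[K]_3) : D1_aut T -> D1_aut T' -> D1_aut (T *m T').
Proof.
move=> [hu hT] [hu' hT']; split; first by rewrite unitmx_mul hu.
by move=> x y; rewrite -!mulmxA hT' hT.
Qed.

Lemma D1_aut1 : D1_aut (1%:M : 'M[K]_3).
Proof. by split; [exact: unitmx1 | move=> x y; rewrite !mul1mx]. Qed.

Lemma equiv_repr_refl (f : D1_repr K) : equiv_repr f f.
Proof.
exists 1%:M, 1%:M; split; [exact: D1_aut1 | exact: unitmx1 |].
by move=> x; rewrite invmx1 !mul1mx mulmx1.
Qed.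

Lemma equiv_cocycle_sym (f f' : D1_repr K) q q' :
  equiv_cocycle f q f' q' -> equiv_cocycle f' q' f q.
Proof.
case=> T [g] [hT hg hf ->]; exists (invmx T), (invmx g); split.
- exact: D1_aut_inv.
- by rewrite unitmx_inv.
- move=> x; rewrite hf (mulKVmx hT.1) invmxK !mulmxA mulVmx // mul1mx.
  by rewrite mulmxKV.
- by rewrite !mulmxA mulVmx // mul1mx mulmxK // hT.1.
Qed.

Lemma invmxM (A B : 'M[K]_3) : A \in unitmx -> B \in unitmx ->
  invmx (A *m B) = invmx B *m invmx A.
Proof.
move=> hA hB; have hAB : A *m B \in unitmx by rewrite unitmx_mul hA.
apply: (can_inj (mulKmx hAB)); rewrite mulmxV // mulmxA mulmxK //.
by rewrite mulmxV.
Qed.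

Lemma equiv_cocycle_trans (f f' f'' : D1_repr K) q q' q'' :
  equiv_cocycle f q f' q' -> equiv_cocycle f' q' f'' q'' ->
  equiv_cocycle f q f'' q''.
Proof.
case=> T [g] [hT hg hf ->] [T'] [g'] [hT' hg' hf' ->].
exists (T *m T'), (g' *m g); split.
- exact: D1_aut_mul.
- by rewrite unitmx_mul hg'.
- by move=> x; rewrite hf' hf invmxM // !mulmxA.
- by rewrite !mulmxA.
Qed.

Lemma equiv_cocycle_unit (f f' : D1_repr K) q q' :
  equiv_cocycle f q f' q' -> q \in unitmx -> q' \in unitmx.
Proof. by case=> T [g] [[hT _] hg _ ->] hq; rewrite !unitmx_mul hg hq. Qed.

(** A cocycle q' of f' is pulled back to the cocycle g^-1 q' T^-1 of f. *)
Lemma bij_cocycle_transfer (f f' : D1_repr K) q' :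
  equiv_repr f f' -> bij_cocycle f' q' -> exists q, bij_cocycle f q.
Proof.
case=> T [g] [hT hg hf] [hc hu].
exists (invmx g *m q' *m invmx T); split; last first.
  by rewrite !unitmx_mul !unitmx_inv hg hu hT.1.
move=> x y; rewrite -[x](mulKVmx hT.1) -[y](mulKVmx hT.1).
move: (invmx T *m x) (invmx T *m y) => {}x {}y.
rewrite -hT.2 -!mulmxA !(mulKmx hT.1) hc !hf mulmxBr.
by rewrite !mulmxA !mulVmx // !mul1mx.
Qed.

(** Once the table gives the product q^-1 (f(x) q(y)), the left-symmetric
identity is the relation f([x, y]) = f(x) f(y) - f(y) f(x) applied to q(z). *)
Lemma corresponding_lsa_of (f : D1_repr K) q t :
  bij_cocycle f q ->
  (forall x y, q *m prod_of t x y = f x *m (q *m y)) ->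
  corresponding_lsa f q (prod_of t).
Proof.
case=> hc hu hm.
have hm' x y : prod_of t x y = invmx q *m (f x *m (q *m y)).
  by rewrite -hm mulKmx.
split=> //; split.
- move=> x k y z; rewrite !hm'.
  by rewrite !mulmxDr -!scalemxAr.
- move=> y k x z; rewrite !hm' linearP /=.
  by rewrite mulmxDl mulmxDr -!scalemxAl -!scalemxAr.
move=> x y z.
have hb : prod_of t x y - prod_of t y x = D1_bracket x y.
  by apply: (can_inj (mulKmx hu)); rewrite mulmxBr !hm hc.
have : prod_of t (prod_of t x y) z - prod_of t (prod_of t y x) z =
       prod_of t x (prod_of t y z) - prod_of t y (prod_of t x z).
  apply: (can_inj (mulKmx hu)).
  rewrite !mulmxBr !hm -mulmxBl -linearB hb D1_funB mulmxBl.
  by rewrite !mulmxA.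
move/(canRL (subrK _)) => ->; apply/matrixP => i j.
move: (prod_of t x _) (prod_of t y _) (prod_of t (prod_of t y x) z) => *.
by rewrite !mxE; ring.
Qed.

Lemma lmap3_mulE u v w (x : 'cV[K]_3) :
  lmap3 u v w *m x = x o1 0 *: u + x o2 0 *: v + x o3 0 *: w.
Proof.
apply/matrixP => i j; rewrite ord1 !mxE !big_ord_recl big_ord0 !mxE /=.
rewrite addr0 addrA ![u _ _ * _]mulrC ![v _ _ * _]mulrC ![w _ _ * _]mulrC.
by congr (x _ _ * _ + x _ _ * _ + x _ _ * _); apply: val_inj.
Qed.

Lemma repr_of_cv3 (F1 F2 F3 : 'M[K]_3) (h : D1_relations F1 F2 F3) x y z :
  Defs.repr_of h (cv3 x y z) = x *: F1 + y *: F2 + z *: F3.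
Proof. by rewrite /= /basis_fun !mxE. Qed.

Section Basis.
Variables F1 F2 F3 : 'M[K]_3.
Hypothesis h : D1_relations F1 F2 F3.

Lemma bij_cocycleE q1 q2 q3 :
  bij_cocycle (Defs.repr_of h) (lmap3 q1 q2 q3) <->
  [/\ F1 *m q2 = F2 *m q1, F3 *m q1 - F1 *m q3 = q1,
      F3 *m q2 - F2 *m q3 = q2 & lmap3 q1 q2 q3 \in unitmx].
Proof.
split=> [[hc hu]|[h12 h31 h32 hu]].
  have := hc e3 e2; have := hc e3 e1; have := hc e1 e2.
  rewrite !D1_bracketE !cv3_v !repr_of_cv3 !lmap3_mulE !mxE /=.
  rewrite !(scale0r, scale1r, subr0, add0r, addr0).
  rewrite ?(mul0r, mulr0, mul1r, mulr1, oppr0, scale0r, scale1r, subr0, add0r, addr0).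
  by move=> /esym/eqP; rewrite subr_eq0 => /eqP h12 <- <-; split.
split=> // x y.
rewrite D1_bracketE [x]cv3_eta [y]cv3_eta !repr_of_cv3 !lmap3_mulE !mxE /=.
rewrite !(mulmxDl, mulmxDr) -!scalemxAl -!scalemxAr h12.
move/(canRL (subrK _)): h31 => ->; move/(canRL (subrK _)): h32 => ->.
apply/matrixP => i j.
move: (F1 *m q1) (F2 *m q1) (F2 *m q2) (F1 *m q3) (F2 *m q3) (F3 *m q3).
by move=> *; rewrite !mxE; ring.
Qed.

Variables F1' F2' F3' : 'M[K]_3.
Hypothesis h' : D1_relations F1' F2' F3'.

(** By linearity, f' = g (f o T) g^-1 only has to be tested on the basis. *)
Lemma intertwineP (a b c d e f : K) (g : 'M[K]_3) : g \in unitmx ->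
  (forall x, Defs.repr_of h' x =
     g *m Defs.repr_of h (mx3 a b c d e f 0 0 1 *m x) *m invmx g)
  <->
  [/\ F1' *m g = g *m (a *: F1 + d *: F2),
      F2' *m g = g *m (b *: F1 + e *: F2) &
      F3' *m g = g *m (c *: F1 + f *: F2 + F3)].
Proof.
move=> hg; split=> [hf|[h1 h2 h3] x].
  have := hf e3; have := hf e2; have := hf e1.
  rewrite !cv3_v !mulmx_cv3 !repr_of_cv3.
  rewrite !(mul0r, mul1r, mulr0, mulr1, add0r, addr0, scale0r, scale1r).
  by move=> -> -> ->; split; rewrite mulmxKV.
apply: (can_inj (mulmxK hg)); rewrite mulmxKV // [x]cv3_eta.
rewrite mulmx_cv3 !repr_of_cv3 !mulmxDl -!scalemxAl h1 h2 h3.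
rewrite !mulmxDr -!scalemxAr; apply/matrixP => i j.
move: (g *m F1) (g *m F2) (g *m F3) => *; rewrite !mxE; ring.
Qed.

(** The invertibility of g and T need not be checked: it follows from that of
q' = g q T. *)
Lemma equiv_cocycleI a b c d e f (g q q' : 'M[K]_3) : q' \in unitmx ->
  F1' *m g = g *m (a *: F1 + d *: F2) ->
  F2' *m g = g *m (b *: F1 + e *: F2) ->
  F3' *m g = g *m (c *: F1 + f *: F2 + F3) ->
  q' = g *m q *m mx3 a b c d e f 0 0 1 ->
  equiv_cocycle (Defs.repr_of h) q (Defs.repr_of h') q'.
Proof.
move=> hu h1 h2 h3 hq; move: (hu); rewrite hq !unitmx_mul => /andP[/andP[hg _] hT].
exists (mx3 a b c d e f 0 0 1), g; split=> //; last exact/intertwineP.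
by apply/D1_autE; split=> //; split; rewrite !mxE.
Qed.

Lemma equiv_cocycleE (q q' : 'M[K]_3) :
  equiv_cocycle (Defs.repr_of h) q (Defs.repr_of h') q' ->
  exists a b c d e f, exists2 g : 'M[K]_3, g \in unitmx &
  [/\ F1' *m g = g *m (a *: F1 + d *: F2),
      F2' *m g = g *m (b *: F1 + e *: F2),
      F3' *m g = g *m (c *: F1 + f *: F2 + F3)&
      q' = g *m q *m mx3 a b c d e f 0 0 1].
Proof.
case=> T [g] [/D1_autE[hT [T1 T2 T3]] hg].
rewrite [T]mx3_eta T1 T2 T3 => /(intertwineP _ _ _ _ _ _ hg)[h1 h2 h3] hq.
by do 6!eexists; exists g; last by split; eassumption.
Qed.

(** Equivalences of representations with T the identity. *)
Lemma equiv_reprI (g : 'M[K]_3) : g \in unitmx ->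
  F1' *m g = g *m F1 -> F2' *m g = g *m F2 -> F3' *m g = g *m F3 ->
  equiv_repr (Defs.repr_of h) (Defs.repr_of h').
Proof.
move=> hg h1 h2 h3; exists (mx3 1 0 0 0 1 0 0 0 1), g; split=> //.
  by rewrite -mx3_scalar; apply: D1_aut1.
by apply/intertwineP; rewrite // !scale1r !scale0r !add0r ?addr0.
Qed.

End Basis.

Lemma classification1 (f : D1_repr K) q0 t :
  bij_cocycle f q0 ->
  (forall x y, q0 *m prod_of t x y = f x *m (q0 *m y)) ->
  (forall q, bij_cocycle f q -> equiv_cocycle f q f q0) ->
  classification f [:: (q0, t)].
Proof.
move=> hb hm hq; split.
- by move=> p'; rewrite inE => /eqP->; split=> //; apply: corresponding_lsa_of.
- by move=> q /hq; exists (q0, t); rewrite ?inE.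
- by move=> p1 p2; rewrite !inE => /eqP-> /eqP->.
Qed.

Lemma classification2 (f : D1_repr K) q0 q1 t0 t1 :
  bij_cocycle f q0 -> bij_cocycle f q1 ->
  (forall x y, q0 *m prod_of t0 x y = f x *m (q0 *m y)) ->
  (forall x y, q1 *m prod_of t1 x y = f x *m (q1 *m y)) ->
  (forall q, bij_cocycle f q ->
     equiv_cocycle f q f q0 \/ equiv_cocycle f q f q1) ->
  ~ equiv_cocycle f q0 f q1 ->
  classification f [:: (q0, t0); (q1, t1)].
Proof.
move=> hb hb' hm hm' hq hne; split.
- by move=> p0; rewrite !inE => /orP[] /eqP->; split=> //;
    apply: corresponding_lsa_of.
- move=> q /hq[]; first by exists (q0, t0); rewrite // !inE eqxx.
  by exists (q1, t1); rewrite // !inE eqxx orbT.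
- move=> p1 p2; rewrite !inE => /orP[] /eqP-> /orP[] /eqP-> //.
  by move/equiv_cocycle_sym.
Qed.

End Cocycles.

(** * Entrywise computation *)

(* Delete the zeros and ones produced by products of sparse matrices. *)
Ltac drop01 :=
  rewrite ?(mul0r, mulr0, mul1r, mulr1, add0r, addr0, oppr0, subr0, sub0r).

(* From a goal that begins with a bijective cocycle q, introduce its columns
   (x1, x2, x3), (y1, y2, y3), (z1, z2, z3) and the scalar equations they satisfy:
   p1, p2, p3 for F_1 q_2 = F_2 q_1; a1, a2, a3 and b1, b2, b3 for the equations
   giving q_1 and q_2; hD for the determinant. *)
Ltac cocycle_entries :=
  let q := fresh "q" in
  move=> q; rewrite [q]mx3_eta;
  move: (q o1 o1) (q o1 o2) (q o1 o3) (q o2 o1) (q o2 o2) (q o2 o3)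
    (q o3 o1) (q o3 o2) (q o3 o3) => x1 y1 z1 x2 y2 z2 x3 y3 z3 {q};
  move/bij_cocycleE; rewrite -/(mx3 _ _ _ _ _ _ _ _ _) unit_mx3;
  rewrite !mx3_F ?mx3D !mulmx_cv3 !cv3E; drop01;
  case=> /cv3_inj[p1 p2 p3] /cv3_inj[a1 a2 a3] /cv3_inj[b1 b2 b3] hD.

(* Evaluate all matrix expressions of the goal to explicit entries. *)
Ltac mx3_norm :=
  rewrite ?lmap3_cv3 ?(cv3_v, cv3Z, cv3N, cv3D) ?lmap3_cv3 ?mx3_F ?mx3D
          ?mx3Z ?mx3D ?mx3M ?mulmx_cv3 ?(cv3Z, cv3N, cv3D).

(* Prove X != 0 by rewriting X as v, whose factors are known to be nonzero. *)
Ltac prove_nonzero v :=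
  match goal with |- is_true (?X != 0) =>
    have -> : X = v by ring end;
  rewrite ?mulf_neq0 ?oppr_eq0 ?oner_eq0 //.

(* Prove that an explicit matrix is a bijective cocycle, up to det != 0. *)
Ltac bij_target :=
  apply/bij_cocycleE; mx3_norm; rewrite unit_mx3;
  split; [congr cv3; ring | congr cv3; ring | congr cv3; ring | ].

(* Compare a multiplication table with q^-1 (f(x) q(y)) for generic x and y. *)
Ltac lsa_target :=
  let x := fresh "x" in let y := fresh "y" in
  move=> x y; rewrite [x]cv3_eta [y]cv3_eta;
  move: (x o1 0) (x o2 0) (x o3 0) (y o1 0) (y o2 0) (y o3 0) => ? ? ? ? ? ? {x y};
  rewrite /AI /AII /AIII /AIV /AV /AVI /AVII /BI /BII repr_of_cv3;
  rewrite /prod_of ?big_cons big_nil ?addr0 /= !mxE /=;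
  mx3_norm; congr cv3; ring.

(* Refute hD : det != 0 when the known values make the determinant vanish. *)
Ltac contradict hD := case/eqP: hD; subst; ring.

(* Replace the left-hand side of hD : X != 0 by an equal expression v. *)
Ltac rewrite_det hD v :=
  match type of hD with is_true (?X != 0) =>
    let e := fresh in
    have e : X = v by [ring]; rewrite e in hD; clear e end.

(* Prove A = B from H : L = R when A - B = L - R in every commutative ring. *)
Ltac by_linear H :=
  apply/eqP; rewrite -subr_eq0;
  match type of H with ?L = ?R =>
  match goal with |- is_true (?X == 0) =>
    let e := fresh in
    have e : X = L - R by [ring]; rewrite e subr_eq0; apply/eqP; exact: H end end.

Ltac mx3_field := mx3_norm; congr mx3; field.

(* From an equivalence of explicit cocycles, derive its scalar equations: T has
   rows (a, b, c), (d, e, f), (0, 0, 1), and g has rows (g1, g2, g3),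
   (g4, g5, g6), (g7, g8, g9).  The nine equations a1 to a9 express
   F_1' g = g (a F_1 + d F_2) row by row, b1 to b9 and c1 to c9 the same for F_2'
   and F_3', and d1 to d9 express q' = g q T. *)
Ltac equiv_entries :=
  let g := fresh "g" in
  move/equiv_cocycleE => [a [b [c [d [e [f [g]]]]]]];
  rewrite [g]mx3_eta;
  move: (g o1 o1) (g o1 o2) (g o1 o3) (g o2 o1) (g o2 o2) (g o2 o3)
    (g o3 o1) (g o3 o2) (g o3 o3) => g1 g2 g3 g4 g5 g6 g7 g8 g9 {g};
  rewrite unit_mx3 => hD; mx3_norm; drop01;
  case=> /mx3_inj[[a1 a2 a3] [a4 a5 a6] [a7 a8 a9]];
  move=> /mx3_inj[[b1 b2 b3] [b4 b5 b6] [b7 b8 b9]];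
  move=> /mx3_inj[[c1 c2 c3] [c4 c5 c6] [c7 c8 c9]];
  move=> /mx3_inj[[d1 d2 d3] [d4 d5 d6] [d7 d8 d9]].

(** * The general bijective cocycle of each family *)

Section CocycleForms.
Variable K : numFieldType.

Lemma mul_fixed_eq0 (k x : K) : k != 1 -> k * x = x -> x = 0.
Proof.
move=> hk /eqP; rewrite -subr_eq0 -{2}[x]mul1r -mulrBl mulf_eq0 subr_eq0.
by rewrite (negbTE hk) => /eqP.
Qed.

Lemma AV_cocycle_form (c : K) q : bij_cocycle (AV c) q ->
  c = 1 /\ exists x p t s w,
  [/\ x != 0, s != 0 & q = mx3 x p t 0 0 s 0 s w].
Proof.
move: q; cocycle_entries.
have hc : c = 1.
  apply/eqP; apply: contraT => hc; have e3 := mul_fixed_eq0 hc a3.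
  by rewrite e3 addr0 in a1; have e1 := mul_fixed_eq0 hc a1; contradict hD.
rewrite hc in a1 a2 a3 b1 b2 b3.
have e3 : x3 = 0 by by_linear a1.
have e2 : y2 = 0 by rewrite -b2; ring.
have e : y3 = z2 by by_linear b1.
split=> //; exists x1, y1, z1, z2, z3; subst.
rewrite_det hD (- (x1 * z2 ^+ 2)).
move: hD; rewrite oppr_eq0 mulf_eq0 expf_eq0 /= negb_or => /andP[-> ->].
by split.
Qed.

Lemma AVI_cocycle_form (c : K) q : bij_cocycle (AVI c) q ->
  c = 1 /\ exists x p t r w,
  [/\ x != 0, r != 0 & q = mx3 x p t 0 r w 0 0 r].
Proof.
move: q; cocycle_entries.
have hc : c = 1.
  apply/eqP; apply: contraT => hc.
  have e3 := mul_fixed_eq0 hc b3; have e2 : c * x2 = 0.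
    by by_linear a2.
  have e0 : c * y2 = z3 by by_linear b2.
  have e1 : x1 = 0 by apply: (mul_fixed_eq0 hc); rewrite -[RHS]a1 -p2; drop01.
  case: (eqVneq c 0) => [c0|c0]; last first.
    by move/eqP: e2; rewrite mulf_eq0 (negbTE c0) => /eqP e2; contradict hD.
  by have z0 : z3 = 0; [rewrite -e0 c0 mul0r | contradict hD].
rewrite hc in a1 a2 a3 b1 b2 b3.
have e2 : x2 = 0 by by_linear a2.
have e3 : y3 = 0 by by_linear b1.
have e : y2 = z3 by by_linear b2.
split=> //; exists x1, y1, z1, z3, z2; subst.
rewrite_det hD (x1 * z3 ^+ 2).
move: hD; rewrite mulf_eq0 expf_eq0 /= negb_or => /andP[-> ->].
by split.
Qed.

Lemma AVII_cocycle_form (c : K) q : bij_cocycle (AVII c) q ->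
  c = -1 /\ exists x p t r,
  [/\ x != 0, r != 0 & q = mx3 x p t 0 r 0 0 0 (- r)].
Proof.
move: q; cocycle_entries.
have hc : c = -1.
  apply/eqP; apply: contraT => hc.
  rewrite -p1 -p2 in hD.
  have hc1 : c + 2%:R != 1.
    by apply: contra hc => /eqP hc; rewrite -(addrK 2%:R c) hc; apply/eqP; ring.
  have e1 := mul_fixed_eq0 hc1 a1; contradict hD.
rewrite hc in a1 a2 a3 b1 b2 b3.
have e0 : z3 = - y2 by by_linear (esym b2).
have e1 : z2 = 0 by by_linear (esym b1).
have e3 : y3 = 0.
  have /eqP : 2 * y3 = 0 by by_linear (esym b3).
  by rewrite mulf_eq0 pnatr_eq0 => /eqP.
split=> //; exists x1, y1, z1, y2; subst.
rewrite_det hD (- (x1 * y2 ^+ 2)).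
move: hD; rewrite oppr_eq0 mulf_eq0 expf_eq0 /= negb_or => /andP[-> ->].
by split.
Qed.

Lemma BI_cocycle_form (c : K) q : bij_cocycle (BI c) q ->
  c = 1 /\ exists a b d x y t,
    mx3 x y t a b x b d y \in unitmx /\ q = mx3 x y t a b x b d y.
Proof.
move: q; cocycle_entries.
have hc : c = 1.
  apply/eqP; apply: contraT => hc.
  have e1 := mul_fixed_eq0 hc a2; have e2 := mul_fixed_eq0 hc a3.
  have e3 := mul_fixed_eq0 hc b2; have e4 := mul_fixed_eq0 hc b3.
  by contradict hD.
rewrite hc in a1 b1.
have e2 : z2 = x1 by by_linear (esym a1).
have e3 : z3 = y1 by by_linear (esym b1).
split=> //; exists x2, y2, y3, x1, y1, z1; rewrite unit_mx3; subst; split=> //.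
Qed.

Lemma BII_cocycle_form (c : K) q : bij_cocycle (BII c) q ->
  c != 0 /\ exists2 y, y != 0 & exists t u, q = mx3 0 y t y 0 u 0 0 (c * y).
Proof.
move: q; cocycle_entries.
have hc : c != 0.
  apply/eqP => hc; rewrite hc in a2.
  have e1 : z3 = 0 by by_linear (esym a2).
  by contradict hD.
have e1 : x1 = 0 by apply: (mulfI hc); by_linear a1.
have e2 : y2 = 0 by apply: (mulfI hc); by_linear b2.
have e3 : z3 = c * x2 by by_linear (esym a2).
have e4 : y1 = x2 by apply: (mulfI hc); rewrite -e3; by_linear b1.
split=> //; exists y1; last by exists z1, z2; subst.
by apply/eqP => e; subst; contradict hD.
Qed.

Lemma AIV_cocycle_form (b c : K) q : bij_cocycle (AIV b c) q ->
  [/\ c = 1, b != 0 & exists z p r s t w,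
   [/\ z != 0, b * p ^+ 2 - r * t != 0, (b - 1) * r = 0 &
    q = mx3 0 p t 0 r (b * p) z s w]].
Proof.
move: q; cocycle_entries.
have hb : b != 0.
  apply/eqP => hb; rewrite hb in b1 b2.
  have e1 : z2 = 0 by by_linear (esym b1).
  by rewrite mul0r in b2; contradict hD.
have e1 : x1 = 0 by apply: (mulfI hb); by_linear a1.
have e2 : z2 = b * y1 by by_linear (esym b1).
have hc : c = 1.
  apply/eqP; apply: contraT => hc.
  by have e3 := mul_fixed_eq0 hc a3; contradict hD.
split=> //; exists x3, y1, y2, y3, z1, z3.
subst; rewrite_det hD (x3 * (b * y1 ^+ 2 - y2 * z1)).
move: hD; rewrite mulf_eq0 negb_or => /andP[-> ->]; split=> //.
by by_linear b2.
Qed.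

Lemma AII_cocycle_form (a c : K) q : bij_cocycle (AII a c) q ->
  [/\ a = 1, c = 1 & exists x1 y1 t s x3 y3 w,
   [/\ s != 0, x1 * y3 - y1 * x3 != 0 &
    q = mx3 x1 y1 t 0 0 s x3 y3 w]].
Proof.
move: q; cocycle_entries.
have e : x2 = 0 /\ y2 = 0.
  case: (eqVneq a 1) => [ha|ha]; last first.
    by rewrite (mul_fixed_eq0 ha a2) (mul_fixed_eq0 ha b2).
  by rewrite ha in a1 b1; split; [by_linear a1|by_linear b1].
case: e => ex ey; subst.
have ha : a = 1.
  apply/eqP; apply: contraT => ha.
  rewrite !addr0 in a1 b1.
  by have e1 := mul_fixed_eq0 ha a1; have e2 := mul_fixed_eq0 ha b1; contradict hD.
have hc : c = 1.
  apply/eqP; apply: contraT => hc.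
  by have e1 := mul_fixed_eq0 hc a3; have e2 := mul_fixed_eq0 hc b3; contradict hD.
split=> //; exists x1, y1, z1, z2, x3, y3, z3.
rewrite_det hD (- (z2 * (x1 * y3 - y1 * x3))).
by move: hD; rewrite oppr_eq0 mulf_eq0 negb_or => /andP[-> ->].
Qed.

(** The eigenvectors of f(e_3) lie on a line, which cannot contain two
independent columns of q. *)
Lemma AIII_no_cocycle (a : K) : ~ exists q, bij_cocycle (AIII a) q.
Proof.
case; cocycle_entries.
have e (k x y : K) : k * x + y = x -> k * y = y -> y = 0.
  case: (eqVneq k 1) => [->|hk] h1 h2; first by by_linear h1.
  exact: mul_fixed_eq0 hk h2.
have x30 := e _ _ _ a2 a3; have y30 := e _ _ _ b2 b3; subst.
rewrite !addr0 in a2 b2.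
have x20 := e _ _ _ a1 a2; have y20 := e _ _ _ b1 b2.
by contradict hD.
Qed.

(** At least two of a, b, c equal 1; a permutation of the basis of V brings them
to the first two places. *)
Lemma AI_cocycle_equiv (a b c : K) :
  (exists q, bij_cocycle (AI a b c) q) ->
  exists lam, equiv_repr (AI a b c) (AI 1 1 lam).
Proof.
case; cocycle_entries.
case: (eqVneq a 1) => [->|ha]; case: (eqVneq b 1) => [->|hb];
  case: (eqVneq c 1) => [->|hc];
  do ?[have ha1 := mul_fixed_eq0 ha a1; have ha2 := mul_fixed_eq0 ha b1];
  do ?[have hb1 := mul_fixed_eq0 hb a2; have hb2 := mul_fixed_eq0 hb b2];
  do ?[have hc1 := mul_fixed_eq0 hc a3; have hc2 := mul_fixed_eq0 hc b3];
  try contradict hD.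
- by exists 1; apply: equiv_repr_refl.
- by exists c; apply: equiv_repr_refl.
- exists b; apply: (equiv_reprI _ _ (g := mx3 1 0 0 0 0 1 0 1 0)); last first.
  + by mx3_norm; congr mx3; ring.
  + by rewrite mul0mx mulmx0.
  + by rewrite mul0mx mulmx0.
  + by rewrite unit_mx3; prove_nonzero (-1 : K).
- exists a; apply: (equiv_reprI _ _ (g := mx3 0 0 1 0 1 0 1 0 0)); last first.
  + by mx3_norm; congr mx3; ring.
  + by rewrite mul0mx mulmx0.
  + by rewrite mul0mx mulmx0.
  + by rewrite unit_mx3; prove_nonzero (-1 : K).
Qed.

End CocycleForms.

(** * Families with a single class of cocycles *)

Section SingleClass.
Variable K : numFieldType.

Lemma AV_classification : classification (AV (1 : K))
     [:: (lmap3 v1 v3 v2,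
          [:: ((o2, o3), e1); ((o3, o1), e1); ((o3, o2), e1 + e2)])].
Proof.
have hb : bij_cocycle (AV (1 : K)) (lmap3 v1 v3 v2).
  by bij_target; prove_nonzero (- 1 : K).
apply: classification1 => //.
- by lsa_target.
- move=> q /AV_cocycle_form[_ [x [p [t [s [w [hx hs ->]]]]]]].
  (* The entry f of T makes the last coordinate of q_3 vanish, and the entry
     - w / s of g undoes the change of F_3 into F_3 + f E21. *)
  apply: (equiv_cocycleI _ _
    (a := x^-1) (b := - p / (s * x)) (c := (p * w / s - t + w) / x)
    (d := 0) (e := s^-1) (f := - w / s)
    (g := mx3 1 (- w / s) 0 0 s^-1 0 0 0 1) hb.2);
    mx3_field; rewrite ?hx ?hs //.
Qed.

Lemma AVI_classification : classification (AVI (1 : K))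
     [:: (lmap3 v1 v2 v3,
          [:: ((o2, o3), e2); ((o3, o1), e1); ((o3, o2), 2%:R *: e2);
              ((o3, o3), e3 + e1)])].
Proof.
have hb : bij_cocycle (AVI (1 : K)) (lmap3 v1 v2 v3).
  by bij_target; prove_nonzero (1 : K).
apply: classification1 => //.
- by lsa_target.
- move=> q /AVI_cocycle_form[_ [x [p [t [r [w [hx hr ->]]]]]]].
  (* The shift of e_3 by f e_2 and the entry f of the unipotent factor of g each
     add f r to the middle coordinate w of q_3, whence the factor 2. *)
  apply: (equiv_cocycleI _ _
    (a := r / x) (b := - p / x) (c := (p * w / (2 * r) - t) / x)
    (d := 0) (e := 1) (f := - w / (2 * r))
    (g := r^-1 *: mx3 1 0 0 0 1 (- w / (2 * r)) 0 0 1) hb.2);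
    mx3_field; rewrite ?hx ?hr ?pnatr_eq0 //.
Qed.

Lemma AVII_classification : classification (AVII (-1 : K))
     [:: (lmap3 v1 v2 (- v3),
          [:: ((o2, o2), e1); ((o2, o3), - e2); ((o3, o1), e1);
              ((o3, o3), - e3)])].
Proof.
have hb : bij_cocycle (AVII (-1 : K)) (lmap3 v1 v2 (- v3)).
  by bij_target; prove_nonzero (- 1 : K).
apply: classification1 => //.
- by lsa_target.
- move=> q /AVII_cocycle_form[_ [x [p [t [r [hx hr ->]]]]]].
  apply: (equiv_cocycleI _ _
    (a := r / x) (b := - p / x) (c := - t / x)
    (d := 0) (e := 1) (f := 0)
    (g := r^-1 *: mx3 1 0 0 0 1 0 0 0 1) hb.2);
    mx3_field; rewrite ?hx ?hr ?pnatr_eq0 //.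
Qed.

Lemma AII_classification : classification (AII (1 : K) 1)
     [:: (lmap3 v3 v1 v2,
          [:: ((o3, o1), e1); ((o3, o2), e2); ((o3, o3), e3 + e2)])].
Proof.
have hb : bij_cocycle (AII (1 : K) 1) (lmap3 v3 v1 v2).
  by bij_target; prove_nonzero (1 : K).
apply: classification1 => //.
- by lsa_target.
- move=> q /AII_cocycle_form[_ _ [a [b [t [s [c [d [w [hs hD ->]]]]]]]]].
  set D := a * d - b * c in hD.
  (* As F_1 = F_2 = 0, the first two rows of T are free: T is chosen as the
     product of the inverse of g q and the listed cocycle. *)
  apply: (equiv_cocycleI _ _
    (a := - (b * s) / D) (b := d * s / D) (c := (b * w - t * d) / D)
    (d := a * s / D) (e := - (c * s) / D) (f := (c * t - a * w) / D)
    (g := s^-1 *: mx3 1 0 0 0 1 0 0 0 1) hb.2);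
    mx3_norm; congr mx3; rewrite /D in hD *; field; rewrite ?hs ?hD //.
Qed.

Lemma AI_classification (lam : K) : classification (AI 1 1 lam)
        [:: (lmap3 v1 v2 v3,
             [:: ((o3, o1), e1); ((o3, o2), e2); ((o3, o3), lam *: e3)])].
Proof.
have hb : bij_cocycle (AI 1 1 lam) (lmap3 v1 v2 v3).
  by bij_target; prove_nonzero (1 : K).
apply: classification1 => //.
- by lsa_target.
- move=> q hq; have hu := hq.2.
  case: (eqVneq lam 1) => [e|hlam].
    rewrite e in hb *.
    (* F_3 is the identity, so every g commutes with it. *)
    apply: (equiv_cocycleI _ _
      (a := 1) (b := 0) (c := 0) (d := 0) (e := 1) (f := 0)
      (g := invmx q) hb.2).
    + by rewrite !scaler0 addr0 mul0mx mulmx0.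
    + by rewrite !scaler0 addr0 mul0mx mulmx0.
    + rewrite !scaler0 !add0r (_ : diag3 1 1 1 = 1%:M) ?mul1mx ?mulmx1 //.
      by rewrite !mx3_F.
    + rewrite mulVmx // mul1mx; mx3_norm; congr mx3.
  move: q hq {hu}; cocycle_entries.
  have e3 := mul_fixed_eq0 hlam a3; have e4 := mul_fixed_eq0 hlam b3; subst.
  rewrite_det hD (z3 * (x1 * y2 - y1 * x2)).
  move: hD; rewrite mulf_eq0 negb_or => /andP[hs hD].
  mx3_norm; rewrite -[mx3 1 _ _ _ _ _ _ _ _]/(lmap3 _ _ _).
  set D := x1 * y2 - y1 * x2 in hD.
  (* The scaling g commutes with F_3, and T is the inverse of g q. *)
  apply: (equiv_cocycleI _ _
    (a := y2 / D) (b := - y1 / D) (c := (y1 * z2 - z1 * y2) / D)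
    (d := - x2 / D) (e := x1 / D) (f := (x2 * z1 - x1 * z2) / D)
    (g := mx3 1 0 0 0 1 0 0 0 z3^-1));
    first by rewrite unit_mx3; prove_nonzero (1 : K).
  all: mx3_norm; congr mx3; rewrite /D in hD *; field; rewrite ?hs ?hD //.
Qed.

End SingleClass.

(** * The family (BI): congruence of symmetric matrices *)

Section BI.
Variable K : numClosedFieldType.
Implicit Types (a b c d e f k x y t : K).

(** The general cocycle of BI 1.  Moving its first row to the bottom gives the
symmetric matrix Q with rows (a, b, x), (b, d, y), (x, y, t). *)
Definition sym_cocycle a b d x y t : 'M[K]_3 := mx3 x y t a b x b d y.

(** The symmetric matrix Q may be replaced by k T^t Q T, where T has rows
(al, be, ga), (de, ep, ze), (0, 0, 1). *)
Lemma BI_congruence k al be ga de ep ze a b d x y t a' b' d' x' y' t' :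
  k != 0 -> al * ep - be * de != 0 -> sym_cocycle a b d x y t \in unitmx ->
  a' = k * (a * al ^+ 2 + 2%:R * b * al * de + d * de ^+ 2) ->
  b' = k * (a * al * be + b * (al * ep + be * de) + d * de * ep) ->
  d' = k * (a * be ^+ 2 + 2%:R * b * be * ep + d * ep ^+ 2) ->
  x' = k * (al * (a * ga + b * ze + x) + de * (b * ga + d * ze + y)) ->
  y' = k * (be * (a * ga + b * ze + x) + ep * (b * ga + d * ze + y)) ->
  t' = k * (a * ga ^+ 2 + 2%:R * b * ga * ze + d * ze ^+ 2
            + 2%:R * x * ga + 2%:R * y * ze + t) ->
  equiv_cocycle (BI 1) (sym_cocycle a b d x y t)
                (BI 1) (sym_cocycle a' b' d' x' y' t').
Proof.
move=> hk hD hu ea eb ed ex ey et.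
pose T := mx3 al be ga de ep ze 0 0 1.
(* This is k T^t, with its last row and its last column moved to the front. *)
pose g := k *: mx3 1 ga ze 0 al de 0 be ep.
have e : sym_cocycle a' b' d' x' y' t' = g *m sym_cocycle a b d x y t *m T.
  by rewrite /sym_cocycle /g /T; mx3_norm; congr mx3;
    rewrite ?ea ?eb ?ed ?ex ?ey ?et; ring.
have hu' : sym_cocycle a' b' d' x' y' t' \in unitmx.
  have hg : g \in unitmx.
    rewrite /g mx3Z unit_mx3.
    rewrite [X in X != 0](_ : _ = k ^+ 3 * (al * ep - be * de)); last by ring.
    by rewrite mulf_neq0 // expf_neq0.
  have hT : T \in unitmx.
    rewrite unit_mx3.
    by rewrite [X in X != 0](_ : _ = al * ep - be * de); last by ring.
  by rewrite e !unitmx_mul hg hu hT.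
apply: (equiv_cocycleI _ _ (g := g) hu' _ _ _ e).
all: by rewrite /g; mx3_norm; congr mx3; ring.
Qed.

(** Equivalence with one of the two cocycles of the classification: their
symmetric matrices are those of the quadratic forms X_2 ^ 2 + 2 X_1 X_3 and
X_1 ^ 2 + X_2 ^ 2 + X_3 ^ 2. *)
Definition BI_listed q :=
  equiv_cocycle (BI 1) q (BI 1) (sym_cocycle 0 0 1 1 0 0) \/
  equiv_cocycle (BI 1) q (BI 1) (sym_cocycle 1 0 1 0 0 1).

Lemma BI_listed_equiv q q' :
  equiv_cocycle (BI 1) q (BI 1) q' -> BI_listed q' -> BI_listed q.
Proof.
by move=> h [h'|h']; [left|right]; exact: equiv_cocycle_trans h h'.
Qed.

(** Completing the square makes b and y vanish when d != 0, which leaves this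
form; the block has rank 1 if a = 0, and rank 2 otherwise. *)
Lemma BI_listed_b0y0 a d x t : d != 0 -> sym_cocycle a 0 d x 0 t \in unitmx ->
  BI_listed (sym_cocycle a 0 d x 0 t).
Proof.
move=> hd hu.
have : d * (a * t - x ^+ 2) != 0.
  move: (hu); rewrite unit_mx3; congr (_ != 0); ring.
rewrite mulf_eq0 negb_or => /andP[_ hD].
case: (eqVneq a 0) => [a0|ha]; [left|right].
  subst; have hx : x != 0 by apply: contraNneq hD => ->; apply/eqP; ring.
  (* The shift of e_3 by - t / (2 x) e_1 removes t. *)
  by apply: (@BI_congruence d^-1 (d / x) 0 (- t / (2%:R * x)) 0 1 0
    _ _ _ _ _ _ _ _ _ _ _ _ _ _ hu);
    rewrite ?invr_eq0 ?mulr1 ?mul0r ?subr0 ?mulf_neq0 ?invr_eq0 //;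
    field; rewrite ?hx ?hd ?pnatr_eq0.
have h1 := @BI_congruence 1 1 0 (- x / a) 0 1 0 _ _ _ _ _ _ a 0 d 0 0
   (t - x ^+ 2 / a) ltac:(by rewrite oner_eq0)
   ltac:(by rewrite mulr1 mul0r subr0 oner_eq0) hu
   ltac:(ring) ltac:(ring) ltac:(ring) ltac:(by field) ltac:(ring) ltac:(by field).
have hu1 := equiv_cocycle_unit h1 hu.
apply: equiv_cocycle_trans h1 _.
(* The form is now diagonal, and square roots make its entries equal. *)
have ht : t - x ^+ 2 / a != 0.
  apply: contra hD => /eqP h; apply/eqP.
  rewrite (_ : a * t - _ = a * (t - x ^+ 2 / a)); last by field.
  by rewrite h mulr0.
move: (_ - _) ht hu1 => s hs hu1.
apply: (@BI_congruence s^-1 (sqrtC (s / a)) 0 0 0 (sqrtC (s / d)) 0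
    _ _ _ _ _ _ _ _ _ _ _ _ _ _ hu1);
  rewrite ?invr_eq0 ?mul0r ?subr0 ?mulf_neq0 ?sqrtC_eq0
    ?mulf_neq0 ?invr_eq0 ?sqrtCK //;
  by field; rewrite ?hs ?ha ?hd.
Qed.

Lemma BI_listed_d_neq0 a b d x y t : d != 0 -> sym_cocycle a b d x y t \in unitmx ->
  BI_listed (sym_cocycle a b d x y t).
Proof.
move=> hd hu.
have h1 := @BI_congruence 1 1 0 0 (- b / d) 1 (- y / d) _ _ _ _ _ _
   (a - b ^+ 2 / d) 0 d (x - b * y / d) 0 (t - y ^+ 2 / d)
   ltac:(by rewrite oner_eq0)
   ltac:(by rewrite mulr1 mul0r subr0 oner_eq0) hu
   ltac:(by field) ltac:(by field) ltac:(ring)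
   ltac:(by field) ltac:(by field) ltac:(by field).
have hu1 := equiv_cocycle_unit h1 hu.
by apply: BI_listed_equiv h1 _; apply: BI_listed_b0y0.
Qed.

Lemma BI_listed_all a b d x y t : sym_cocycle a b d x y t \in unitmx ->
  BI_listed (sym_cocycle a b d x y t).
Proof.
move=> hu; case: (eqVneq d 0) => [d0|hd]; last exact: BI_listed_d_neq0.
have n1 : (1 : K) != 0 by rewrite oner_eq0.
case: (eqVneq a 0) => [a0|ha].
  have hb : b != 0.
    apply: contraTneq hu => b0; rewrite unit_mx3 a0 d0 b0 negbK; apply/eqP; ring.
  (* Adding e_1 to e_2 produces the diagonal coefficient d' = 2 b. *)
  have h1 := @BI_congruence 1 1 1 0 0 1 0 _ _ _ _ _ _
   a (a + b) (2%:R * b) x (x + y) t n1 ltac:(by rewrite mulr1 mulr0 subr0) hu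
   ltac:(ring) ltac:(rewrite d0; ring) ltac:(rewrite a0 d0; ring)
   ltac:(ring) ltac:(ring) ltac:(ring).
  have hu1 := equiv_cocycle_unit h1 hu.
  apply: BI_listed_equiv h1 _; apply: BI_listed_d_neq0 => //.
  by rewrite mulf_neq0 // pnatr_eq0.
(* Exchange e_1 and e_2. *)
have h1 := @BI_congruence 1 0 1 0 1 0 0 _ _ _ _ _ _
   d b a y x t n1 ltac:(by rewrite mulr1 mulr0 sub0r oppr_eq0) hu
   ltac:(ring) ltac:(ring) ltac:(ring)
   ltac:(ring) ltac:(ring) ltac:(ring).
have hu1 := equiv_cocycle_unit h1 hu.
by apply: BI_listed_equiv h1 _; apply: BI_listed_d_neq0.
Qed.

(** A block of rank 1 is not congruent to one of rank 2: the block diag(0, 1)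
becomes the matrix with entries k d^2, k d e, k e^2, which is not the identity. *)
Lemma BI_inequiv :
  ~ equiv_cocycle (BI (1 : K)) (sym_cocycle 0 0 1 1 0 0)
                  (BI 1) (sym_cocycle 1 0 1 0 0 1).
Proof.
rewrite /sym_cocycle; equiv_entries.
subst; have /eqP : g1 * d * e = 0 by by_linear (esym d5).
rewrite mulf_eq0 => /orP[/eqP h|/eqP h].
  by move: d4; rewrite h; drop01 => /eqP; rewrite oner_eq0.
by move: d8; rewrite h; drop01 => /eqP; rewrite oner_eq0.
Qed.

Lemma BI_classification : classification (BI (1 : K))
     [:: (lmap3 v1 v3 v2,
          [:: ((o1, o3), e1); ((o2, o2), e1); ((o3, o1), 2%:R *: e1);
              ((o3, o2), e2); ((o3, o3), e3)]);
         (lmap3 v2 v3 v1,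
          [:: ((o1, o1), e3); ((o2, o2), e3); ((o3, o1), e1);
              ((o3, o2), e2); ((o3, o3), 2%:R *: e3)])].
Proof.
have t1 : lmap3 v1 v3 v2 = sym_cocycle 0 0 1 1 0 0 by rewrite /sym_cocycle; mx3_norm.
have t2 : lmap3 v2 v3 v1 = sym_cocycle 1 0 1 0 0 1 by rewrite /sym_cocycle; mx3_norm.
apply: classification2.
- by bij_target; prove_nonzero (- 1 : K).
- by bij_target; prove_nonzero (1 : K).
- by lsa_target.
- by lsa_target.
- move=> q /BI_cocycle_form[_ [a [b [d [x [y [t [hu ->]]]]]]]].
  by rewrite t1 t2; exact: BI_listed_all hu.
- by rewrite t1 t2; exact: BI_inequiv.
Qed.

End BI.

(** * The family (BII) *)

Section BII.
Variable K : numFieldType.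

Lemma BII_reduce (lam : K) q : lam != 0 -> bij_cocycle (BII lam) q ->
  equiv_cocycle (BII lam) q (BII lam) (lmap3 v2 v1 (lam *: v3)) \/
  lam = -1 /\ equiv_cocycle (BII lam) q (BII lam) (lmap3 v2 v1 (v1 - v3)).
Proof.
move=> hlam /BII_cocycle_form[_ [y hy [t [u ->]]]].
have hu : lmap3 v2 v1 (lam *: v3) \in unitmx.
  by mx3_norm; rewrite unit_mx3; prove_nonzero (- lam : K).
have hu' : lmap3 v2 v1 (v1 - v3) \in @unitmx K 3.
  by mx3_norm; rewrite unit_mx3; prove_nonzero (1 : K).
case: (eqVneq lam (-1)) => [e|hlam1]; last first.
  have h1 : lam + 1 != 0 by rewrite addr_eq0.
  left; apply: (equiv_cocycleI _ _ (a := 1) (b := 0) (c := - u / ((lam + 1) * y))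
    (d := 0) (e := 1) (f := - t / ((lam + 1) * y))
    (g := y^-1 *: mx3 1 0 (- t / ((lam + 1) * y))
                      0 1 (- u / ((lam + 1) * y))
                      0 0 1) hu);
  by mx3_field; rewrite ?hy ?h1.
subst; case: (eqVneq t 0) => [t0|ht]; last first.
  (* Here g restricted to the span of v_1 and v_2 sends t v_1 + u v_2 to v_1,
     and T restricted to the span of e_1 and e_2 compensates for it. *)
  right; split=> //.
  apply: (equiv_cocycleI _ _ (a := y^-1) (b := u / y) (c := 0)
    (d := 0) (e := t / y) (f := 0)
    (g := mx3 t^-1 0 0 (- u / t) 1 0 0 0 y^-1) hu');
  by mx3_field; rewrite ?hy ?ht.
case: (eqVneq u 0) => [u0|hu0]; subst; last first.
  right; split=> //.
  apply: (equiv_cocycleI _ _ (a := 0) (b := u / y) (c := 0)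
    (d := y^-1) (e := 0) (f := 0)
    (g := mx3 0 u^-1 0 1 0 0 0 0 y^-1) hu');
  by mx3_field; rewrite ?hy ?hu0.
left; apply: (equiv_cocycleI _ _ (a := 1) (b := 0) (c := 0)
    (d := 0) (e := 1) (f := 0)
    (g := y^-1 *: mx3 1 0 0 0 1 0 0 0 1) hu);
  by mx3_field; rewrite ?hy.
Qed.

(** By the intertwining relation for F_3, the coefficient of v_1 in g q T e_3 is
(lam + 1) g3, with g3 the upper right entry of g.  It vanishes for lam = -1, while
the second cocycle has coefficient 1 there. *)
Lemma BII_inequiv :
  ~ equiv_cocycle (BII (-1 : K)) (lmap3 v2 v1 ((-1) *: v3))
                  (BII (-1)) (lmap3 v2 v1 (v1 - v3)).
Proof.
equiv_entries.
have : (1 : K) = (-1 + 1) * g3 by apply: (etrans d3); rewrite c3; ring.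
by rewrite addNr mul0r => /eqP; rewrite oner_eq0.
Qed.

Lemma BII_classification (lam : K) : lam <> 0 ->
      classification (BII lam)
        ([:: (lmap3 v2 v1 (lam *: v3),
              [:: ((o1, o3), lam *: e1); ((o2, o3), lam *: e2);
                  ((o3, o1), (lam + 1) *: e1); ((o3, o2), (lam + 1) *: e2);
                  ((o3, o3), lam *: e3)])]
         ++ (if lam == -1 then
               [:: (lmap3 v2 v1 (v1 - v3),
                    [:: ((o1, o3), - e1); ((o2, o3), - e2);
                        ((o3, o3), - e3 + e2)])]
             else [::])).
Proof.
move=> /eqP hlam.
have hb : bij_cocycle (BII lam) (lmap3 v2 v1 (lam *: v3)).
  by bij_target; prove_nonzero (- lam : K).
case: eqVneq => [e|hlam1] /=.
  subst; apply: classification2 => //.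
  - by bij_target; prove_nonzero (1 : K).
  - by lsa_target.
  - by lsa_target.
  - by move=> q /(BII_reduce hlam)[|[]]; [left|right].
  - exact: BII_inequiv.
apply: classification1 => //; first by lsa_target.
move=> q /(BII_reduce hlam)[|[e]] //.
by case/eqP: hlam1.
Qed.

End BII.

(** * The family (AIV) *)

Section AIV.
Variable K : numClosedFieldType.

Lemma AIV_reduce (lam : K) q : lam != 0 -> bij_cocycle (AIV lam 1) q ->
  [\/ equiv_cocycle (AIV lam 1) q (AIV lam 1) (lmap3 v3 v1 (lam *: v2)),
      lam = -1 /\ equiv_cocycle (AIV lam 1) q (AIV lam 1) (lmap3 v3 v1 (v1 - v2))
    | lam = 1 /\ equiv_cocycle (AIV lam 1) q (AIV lam 1) (lmap3 v3 v2 v1)].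
Proof.
move=> hlam /AIV_cocycle_form[_ _ [z [p [r [s [t [w [hz hD hr ->]]]]]]]].
have hu : lmap3 v3 v1 (lam *: v2) \in unitmx.
  by mx3_norm; rewrite unit_mx3; prove_nonzero (lam : K).
have hu' : lmap3 v3 v1 (v1 - v2) \in @unitmx K 3.
  by mx3_norm; rewrite unit_mx3; prove_nonzero (- 1 : K).
have hu'' : lmap3 v3 v2 v1 \in @unitmx K 3.
  by mx3_norm; rewrite unit_mx3; prove_nonzero (-1 : K).
case: (eqVneq r 0) => [r0|hr0]; last first.
  have l1 : lam = 1.
    by move/eqP: hr; rewrite mulf_eq0 (negbTE hr0) orbF subr_eq0 => /eqP.
  subst; apply: Or33; split=> //.
  (* T scales e_2 by k / r, where k^2 = r t - p^2 is a nonzero factor of det q. *)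
  have [k hk ->] : exists2 k, k != 0 & t = (k ^+ 2 + p ^+ 2) / r.
    exists (sqrtC (r * t - p ^+ 2)); last by rewrite sqrtCK; field.
    rewrite sqrtC_eq0; apply: contra hD => /eqP h; apply/eqP.
    by by_linear (esym h).
  apply: (equiv_cocycleI _ _ (a := z^-1) (b := - (k * s) / (r * z))
    (c := (p * s / r - w) / z) (d := 0) (e := k / r) (f := - p / r)
    (g := mx3 (r / k ^+ 2) (- p / k ^+ 2) 0 0 k^-1 0 0 0 1) hu'');
  by mx3_field; rewrite ?hk ?hr0 ?hz.
subst; have hp : p != 0.
  by apply: contraNneq hD => ->; apply/eqP; ring.
case: (eqVneq lam (-1)) => [e|hlam1]; last first.
  have h1 : lam + 1 != 0 by rewrite addr_eq0.
  apply: Or31; apply: (equiv_cocycleI _ _ (a := p / z) (b := - s / z)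
    (c := (t * s / ((lam + 1) * p) - w) / z) (d := 0) (e := 1)
    (f := - t / ((lam + 1) * p))
    (g := p^-1 *: mx3 1 (- t / ((lam + 1) * p)) 0 0 1 0 0 0 1) hu);
  by mx3_field; rewrite ?hp ?h1 ?hz.
subst; case: (eqVneq t 0) => [t0|ht]; subst; last first.
  apply: Or32; split=> //.
  apply: (equiv_cocycleI _ _ (a := z^-1) (b := - (t * s) / (p * z)) (c := - w / z)
    (d := 0) (e := t / p) (f := 0)
    (g := mx3 t^-1 0 0 0 p^-1 0 0 0 1) hu');
  by mx3_field; rewrite ?hp ?ht ?hz.
apply: Or31; apply: (equiv_cocycleI _ _ (a := p / z) (b := - s / z)
    (c := - w / z) (d := 0) (e := 1) (f := 0)
    (g := p^-1 *: mx3 1 0 0 0 1 0 0 0 1) hu);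
by mx3_field; rewrite ?hp ?hz.
Qed.

(** The relation for F_3 gives g3 = 0 and g2 = f g1, so the coefficient of v_1 in
g q T e_3 vanishes, while the second cocycle has coefficient 1 there. *)
Lemma AIV_inequiv_m1 :
  ~ equiv_cocycle (AIV (-1 : K) 1) (lmap3 v3 v1 ((-1) *: v2)) (AIV (-1) 1)
     (lmap3 v3 v1 (v1 - v2)).
Proof.
equiv_entries.
have g30 : g3 = 0 by by_linear (esym c3).
have : (1 : K) = (-1 + 1) * g2 by apply: (etrans d3); rewrite c2 g30; ring.
by rewrite addNr mul0r => /eqP; rewrite oner_eq0.
Qed.

(** The kernel of E21, spanned by v_1 and v_3, is stable under g, so q_2 cannot
acquire a component along v_2. *)
Lemma AIV_inequiv_1 :
  ~ equiv_cocycle (AIV (1 : K) 1) (lmap3 v3 v1 (1 *: v2)) (AIV 1 1)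
     (lmap3 v3 v2 v1).
Proof.
equiv_entries.
by move: d5; rewrite b1 b3; drop01 => /eqP; rewrite oner_eq0.
Qed.

Lemma AIV_classification (lam : K) : lam <> 0 ->
      classification (AIV lam 1)
        ([:: (lmap3 v3 v1 (lam *: v2),
              [:: ((o2, o3), lam *: e2); ((o3, o1), e1);
                  ((o3, o2), (lam + 1) *: e2); ((o3, o3), lam *: e3)])]
         ++ (if lam == -1 then
               [:: (lmap3 v3 v1 (v1 - v2),
                    [:: ((o2, o3), - e2); ((o3, o1), e1);
                        ((o3, o3), - e3 + e2)])]
             else [::])
         ++ (if lam == 1 then
               [:: (lmap3 v3 v2 v1,
                    [:: ((o2, o2), e3); ((o3, o1), e1);
                        ((o3, o2), e2); ((o3, o3), 2%:R *: e3)])]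
             else [::])).
Proof.
move=> /eqP hlam.
have hb : bij_cocycle (AIV lam 1) (lmap3 v3 v1 (lam *: v2)).
  by bij_target; prove_nonzero (lam : K).
have ne : (-1 == 1 :> K) = false.
  by rewrite eq_sym -subr_eq0 opprK -(natrD _ 1 1) pnatr_eq0.
case: (eqVneq lam (-1)) => [e|hlam1] /=.
  subst; rewrite ne; apply: classification2 => //.
  - by bij_target; prove_nonzero (- 1 : K).
  - by lsa_target.
  - by lsa_target.
  - move=> q /(AIV_reduce hlam)[|[_]|[/eqP]]; [by left|by right|by rewrite ne].
  - exact: AIV_inequiv_m1.
case: (eqVneq lam 1) => [e|hlam2] /=.
  subst; apply: classification2 => //.
  - by bij_target; prove_nonzero (- 1 : K).
  - by lsa_target.
  - by lsa_target.
  - move=> q /(AIV_reduce hlam)[|[e]|[_]]; [by left| |by right].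
    by case/eqP: hlam1.
  - exact: AIV_inequiv_1.
apply: classification1 => //; first by lsa_target.
move=> q /(AIV_reduce hlam)[|[e]|[e]] //.
  by case/eqP: hlam1.
by case/eqP: hlam2.
Qed.

End AIV.

(** * The classification *)

Theorem proposition3p10 (R : realType) :
  (* (AI) *)
  ((forall a b c : R[i],
      (exists q, bij_cocycle (AI a b c) q) <->
      (exists lam : R[i], equiv_repr (AI a b c) (AI 1 1 lam))) /\
   (forall lam : R[i],
      classification (AI 1 1 lam)
        [:: (lmap3 v1 v2 v3,
             [:: ((o3, o1), e1); ((o3, o2), e2); ((o3, o3), lam *: e3)])])) /\
  (* (AII) *)
  ((forall a c : R[i],
      (exists q, bij_cocycle (AII a c) q) <->
      equiv_repr (AII a c) (AII 1 1)) /\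
   classification (AII (1 : R[i]) 1)
     [:: (lmap3 v3 v1 v2,
          [:: ((o3, o1), e1); ((o3, o2), e2); ((o3, o3), e3 + e2)])]) /\
  (* (AIII) *)
  (forall a : R[i], ~ exists q, bij_cocycle (AIII a) q) /\
  (* (AIV) *)
  ((forall b c : R[i],
      (exists q, bij_cocycle (AIV b c) q) <->
      (exists lam : R[i], lam <> 0 /\ equiv_repr (AIV b c) (AIV lam 1))) /\
   (forall lam : R[i], lam <> 0 ->
      classification (AIV lam 1)
        ([:: (lmap3 v3 v1 (lam *: v2),
              [:: ((o2, o3), lam *: e2); ((o3, o1), e1);
                  ((o3, o2), (lam + 1) *: e2); ((o3, o3), lam *: e3)])]
         ++ (if lam == -1 then
               [:: (lmap3 v3 v1 (v1 - v2),
                    [:: ((o2, o3), - e2); ((o3, o1), e1);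
                        ((o3, o3), - e3 + e2)])]
             else [::])
         ++ (if lam == 1 then
               [:: (lmap3 v3 v2 v1,
                    [:: ((o2, o2), e3); ((o3, o1), e1);
                        ((o3, o2), e2); ((o3, o3), 2%:R *: e3)])]
             else [::])))) /\
  (* (AV) *)
  ((forall c : R[i],
      (exists q, bij_cocycle (AV c) q) <-> equiv_repr (AV c) (AV 1)) /\
   classification (AV (1 : R[i]))
     [:: (lmap3 v1 v3 v2,
          [:: ((o2, o3), e1); ((o3, o1), e1); ((o3, o2), e1 + e2)])]) /\
  (* (AVI) *)
  ((forall c : R[i],
      (exists q, bij_cocycle (AVI c) q) <-> equiv_repr (AVI c) (AVI 1)) /\
   classification (AVI (1 : R[i]))
     [:: (lmap3 v1 v2 v3,
          [:: ((o2, o3), e2); ((o3, o1), e1); ((o3, o2), 2%:R *: e2);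
              ((o3, o3), e3 + e1)])]) /\
  (* (AVII) *)
  ((forall c : R[i],
      (exists q, bij_cocycle (AVII c) q) <-> equiv_repr (AVII c) (AVII (-1))) /\
   classification (AVII (-1 : R[i]))
     [:: (lmap3 v1 v2 (- v3),
          [:: ((o2, o2), e1); ((o2, o3), - e2); ((o3, o1), e1);
              ((o3, o3), - e3)])]) /\
  (* (BI) *)
  ((forall c : R[i],
      (exists q, bij_cocycle (BI c) q) <-> equiv_repr (BI c) (BI 1)) /\
   classification (BI (1 : R[i]))
     [:: (lmap3 v1 v3 v2,
          [:: ((o1, o3), e1); ((o2, o2), e1); ((o3, o1), 2%:R *: e1);
              ((o3, o2), e2); ((o3, o3), e3)]);
         (lmap3 v2 v3 v1,
          [:: ((o1, o1), e3); ((o2, o2), e3); ((o3, o1), e1);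
              ((o3, o2), e2); ((o3, o3), 2%:R *: e3)])]) /\
  (* (BII) *)
  ((forall c : R[i],
      (exists q, bij_cocycle (BII c) q) <->
      (exists lam : R[i], lam <> 0 /\ equiv_repr (BII c) (BII lam))) /\
   (forall lam : R[i], lam <> 0 ->
      classification (BII lam)
        ([:: (lmap3 v2 v1 (lam *: v3),
              [:: ((o1, o3), lam *: e1); ((o2, o3), lam *: e2);
                  ((o3, o1), (lam + 1) *: e1); ((o3, o2), (lam + 1) *: e2);
                  ((o3, o3), lam *: e3)])]
         ++ (if lam == -1 then
               [:: (lmap3 v2 v1 (v1 - v3),
                    [:: ((o1, o3), - e1); ((o2, o3), - e2);
                        ((o3, o3), - e3 + e2)])]
             else [::])))).

Proof.
have transfer (f f' : D1_repr R[i]) p L :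
    classification f' (p :: L) -> equiv_repr f f' -> exists q, bij_cocycle f q.
  by case=> hL _ _ h; apply: bij_cocycle_transfer h (hL p (mem_head _ _)).1.
split; [split|split; [split|split; [|split; [split|split; [split|split; [split|
  split; [split|split; [split|split]]]]]]]].
- move=> a b c; split; first exact: AI_cocycle_equiv.
  by case=> lam; apply: transfer; apply: AI_classification.
- exact: AI_classification.
- move=> a c; split; last by apply: transfer; apply: AII_classification.
  by case=> q /AII_cocycle_form[-> -> _]; apply: equiv_repr_refl.
- exact: AII_classification.
- exact: AIII_no_cocycle.
- move=> b c; split.
    case=> q /AIV_cocycle_form[-> /eqP hb _]; exists b.
    by split=> //; apply: equiv_repr_refl.
  by case=> lam [hlam]; apply: transfer; apply: AIV_classification.
- exact: AIV_classification.
- move=> c; split; last by apply: transfer; apply: AV_classification.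
  by case=> q /AV_cocycle_form[-> _]; apply: equiv_repr_refl.
- exact: AV_classification.
- move=> c; split; last by apply: transfer; apply: AVI_classification.
  by case=> q /AVI_cocycle_form[-> _]; apply: equiv_repr_refl.
- exact: AVI_classification.
- move=> c; split; last by apply: transfer; apply: AVII_classification.
  by case=> q /AVII_cocycle_form[-> _]; apply: equiv_repr_refl.
- exact: AVII_classification.
- move=> c; split; last by apply: transfer; apply: BI_classification.
  by case=> q /BI_cocycle_form[-> _]; apply: equiv_repr_refl.
- exact: BI_classification.
- move=> c; split.
    case=> q /BII_cocycle_form[/eqP hc _]; exists c.
    by split=> //; apply: equiv_repr_refl.
  by case=> lam [hlam]; apply: transfer; apply: BII_classification.
- exact: BII_classification.
Qed.
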